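(* Let $\mathcal{G}=(\mathcal{A},\lim(L(\mathfrak{A})))$ be a regular weighted limit game with $\epsilon\notin L(\mathfrak{A})$, let $r^*$ be the fixed point of $\ell_L$ and $\tau$ the strategy for Player $1$ in $\mathcal{A}$, both defined in the context. Then $\mathrm{val}_{\mathcal{G}}(\tau,v)\ge r^*(v,\mathrm{init}(v))$ for every vertex $v$ of $\mathcal{A}$; that is, $\mathrm{val}_{\mathcal{G}}(\rho)\ge r^*(v,\mathrm{init}(v))$ for every play $\rho$ of $\mathcal{A}$ that starts in $v$ and is consistent with $\tau$.
   Context: Notation: $\overline{\mathbb{N}}=\mathbb{N}\cup\{\infty\}$ ($0\in\mathbb{N}$, $n<\infty$, $n+\infty=\infty$), $\min\emptyset=\infty$; $C$ is a finite nonempty set of colors. Game. $\mathcal{A}$ is an arena: a finite directed graph in which every vertex has an outgoing edge, with vertices partitioned into those of Player $0$ and those of Player $1$, edge weights in $\mathbb{N}$, and a coloring $c$ of vertices by $C$. Plays are infinite paths; the weight $w$ of a finite path is the sum of its edge weights; $c$ is applied vertex-wise to paths. $\mathfrak{A}=(Q,C,q_I,\delta,F_{\mathfrak{A}})$ is a DFA with language $K=L(\mathfrak{A})$. The value of a play is $\mathrm{val}_{\mathcal{G}}(v_0v_1\cdots)=\sup_{j\in\mathbb{N}}\min_{j'>j,\,c(v_0\cdots v_{j'})\in K}w(v_j\cdots v_{j'})$. A strategy for Player $i$ maps each finite vertex sequence ending in a Player $i$ vertex to a successor of that vertex; a play is consistent with it if it follows it at all Player $i$ vertices. For a Player $1$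 strategy $\tau$, $\mathrm{val}_{\mathcal{G}}(\tau,v)=\inf_\rho\mathrm{val}_{\mathcal{G}}(\rho)$ over plays $\rho$ starting in $v$ and consistent with $\tau$. Product arena. $\mathrm{init}(v)=\delta(q_I,c(v))$. The product arena $(V,V_0,V_1,E,w,c)$ has vertices $(v,q)$ with $v$ a vertex of $\mathcal{A}$ and $q\in Q$, belonging to the player owning $v$, colored by $c(v)$; there is an edge from $(v,q)$ to $(v',q')$ iff $(v,v')$ is an edge of $\mathcal{A}$ and $q'=\delta(q,c(v'))$, with the weight of $(v,v')$. Let $F=\{(v,q)\in V\mid q\in F_{\mathfrak{A}}\}$. From here on, $v,v',\overline v$ denote elements of $V$ and $vE$ is the successor set of $v$. For a path $v_0v_1\cdots$ in $\mathcal{A}$, its extension is $(v_0,q_0)(v_1,q_1)\cdots$ with $q_0=\mathrm{init}(v_0)$, $q_{j+1}=\delta(q_j,c(v_{j+1}))$. Rankings. A ranking is a map $r\colon V\to\overline{\mathbb{N}}$. For $F'\subseteq V$ let $\ell_{F'}(r)(v)=0$ if $v\in F'$; $=\min\{r(v),\min_{v'\in vE}w(v,v')+r(v')\}$ if $v\in V_0\setminus F'$; $=\min\{r(v),\max_{v'\in vE}w(v,v')+r(v')\}$ if $v\in V_1\setminus F'$. The ''least fixed point'' of $\ell_{F'}$ is the ranking at which the iteration of $\ell_{F'}$ starting from the constant ranking $\infty$ becomes stationary. Let $\mathrm{cmplt}_{F'}(r)(v)=r(v)$ if $v\notin F'$; $=\min_{v'\in vE}w(v,v')+r(v')$ if $v\in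 F'\cap V_0$; $=\max_{v'\in vE}w(v,v')+r(v')$ if $v\in F'\cap V_1$. Given a ranking $r$, let $\mathfrak{r}_1<\dots<\mathfrak{r}_k$ be the distinct values of $r$ on $F$, $F_h=\{v\in F\mid r(v)\le\mathfrak{r}_h\}$, $r'_h$ the least fixed point of $\ell_{F_h}$, $r''_h=\mathrm{cmplt}_{F_h}(r'_h)$, and $$\ell_L(r)(v)=\min_{1\le h\le k}\max\{r(v),r''_h(v),\mathfrak{r}_h\}.$$ For $v\in V_1$, a successor $\overline v\in vE$ is optimal with respect to $r''_h$ if $r''_h(v)=w(v,\overline v)+r'_h(\overline v)$ (such a successor always exists). Let $r_0$ be the constant ranking $0$, $r_{j+1}=\ell_L(r_j)$ for $j\ge0$, and $r^*=r_n$ for the least $n$ with $r_n=r_{n+1}$ (such $n$ exists). The settling time $t_s(v)$ is the least $j$ with $r_j(v)=r^*(v)$; if $r^*(v)>0$ then $t_s(v)>0$. Types. $v\in V$ is of type zero if $r^*(v)=0$. If $r^*(v)>0$, then (for $F\neq\emptyset$) $r^*(v)=\min_h\max\{r''_h(v),\mathfrak{r}_h\}$ where $\mathfrak{r}_h,F_h,r'_h,r''_h$ are computed with respect to the ranking $r_{t_s(v)-1}$. Then $v$ is of type one if $r^*(v)=r''_h(v)$ for some $h$, and $h(v)$ is the maximal such $h$; otherwise $v$ is of type two, and $h(v)$ is the unique $h$ with $r^*(v)=\mathfrak{r}_h$. Strategy $\tau$. In the product arena, Player $1$ uses memory states $M'=V$: the memory is initialized with the initial vertex, and when moving to a vertex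 $v'$ it is set to $v'$ if $v'\in F$ and is unchanged if $v'\notin F$. At a current vertex $v'\in V_1$ with memory state $v$, $\tau'$ moves: if $v$ is of type zero, to an arbitrary successor of $v'$; if $v$ is of type one, to an optimal successor of $v'$ with respect to $r''_{h(v)}$; if $v$ is of type two and $h(v)=1$, to an arbitrary successor of $v'$; if $v$ is of type two and $h(v)>1$, to an optimal successor of $v'$ with respect to $r''_{h(v)-1}$ (in each case the $r''_h$ are those computed with respect to $r_{t_s(v)-1}$ for the memory state $v$; arbitrary choices are fixed once and for all as functions of $(v',v)$). The strategy $\tau$ in $\mathcal{A}$ maps $v_0\cdots v_j$ to the $\mathcal{A}$-component of the vertex chosen by $\tau'$ on the extension of $v_0\cdots v_j$. (If $F=\emptyset$, $\tau$ is an arbitrary strategy.) *)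

(* Defs.v *)
From HB Require Import structures.
From mathcomp Require Import all_boot all_order.
From mathcomp Require Import boolp classical_sets.

Set Implicit Arguments.
Unset Strict Implicit.
Unset Printing Implicit Defensive.

Import Order.TTheory.

Local Open Scope nat_scope.
Local Open Scope order_scope.

(* The extended naturals: [None] is infinity, and also [\top]; [\bot] is 0.   *)

Definition enat := option nat.

HB.instance Definition _ := Choice.on enat.

Definition le_enat (x y : enat) : bool :=
  match x, y with
  | _, None => true
  | None, Some _ => false
  | Some m, Some n => (m <= n)%N
  end.

Fact le_enat_refl : reflexive le_enat.
Proof. by case=> [n|] /=. Qed.

Fact le_enat_anti : antisymmetric le_enat.
Proof. by case=> [m|] [n|] //= /anti_leq ->. Qed.

Fact le_enat_trans : transitive le_enat.
Proof. by case=> [n|] [m|] [p|] //=; apply: leq_trans. Qed.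

Fact le_enat_total : total le_enat.
Proof. by case=> [m|] [n|] //=; apply: leq_total. Qed.

Fact enat_display : Order.disp_t.
Proof. exact: Order.Disp tt tt. Qed.

HB.instance Definition _ :=
  Order.Le_isPOrder.Build enat_display enat
    le_enat_refl le_enat_anti le_enat_trans.

HB.instance Definition _ :=
  Order.POrder_isTotal.Build enat_display enat le_enat_total.

Fact le0_enat (x : enat) : (Some 0 : enat) <= x.
Proof. by case: x. Qed.

Fact le_enat_oo (x : enat) : x <= (None : enat).
Proof. by case: x. Qed.

HB.instance Definition _ := Order.hasBottom.Build enat_display enat le0_enat.
HB.instance Definition _ := Order.hasTop.Build enat_display enat le_enat_oo.

Definition add_enat (m : nat) (x : enat) : enat := omap (addn m) x.

(* In [nat], the infimum of a nonempty set is its least element; the junk     *)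
(* value for the empty set is 0.                                              *)
Definition least (P : set nat) : nat := infimum 0%N P.

(* The point at which the iteration of [f] from [x] becomes stationary.       *)
Definition stationary (T : Type) (f : T -> T) (x : T) : T :=
  iter (least [set n | iter n f x = iter n.+1 f x]%classic) f x.

(* Player 0 is [false] and Player 1 is [true]. Weights are only meaningful    *)
(* on edges.                                                                  *)
Record arena (C : finType) := Arena {
  vertex :> finType;
  owner : vertex -> bool;
  edge : rel vertex;
  weight : vertex -> vertex -> nat;
  color : vertex -> C;
  edge_serial : forall v, exists v', edge v v'
}.

Record dfa (C : finType) := Dfa {
  state :> finType;
  start : state;
  delta : state -> C -> state;
  final : {set state}
}.

Definition dfa_lang (C : finType) (D : dfa C) (x : seq C) : bool :=
  foldl (@delta C D) (start D) x \in final D.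

Section Games.
Context {C : finType} (A : arena C).

Definition is_play (rho : nat -> A) : Prop :=
  forall i : nat, edge (rho i) (rho i.+1).

Definition infix_weight (rho : nat -> A) (j j' : nat) : nat :=
  (\sum_(j <= i < j') weight (rho i) (rho i.+1))%N.

Definition play_value (K : pred (seq C)) (rho : nat -> A) : enat :=
  supremum \bot
    (range (fun j : nat =>
       infimum \top
         [set (Some (infix_weight rho j j') : enat) | j' in
            [set j' | (j < j')%N /\ K [seq color u | u <- mkseq rho j'.+1]]])
     )%classic.

(* Strategies are only meaningful on nonempty sequences [v0 :: s].            *)
Definition is_strategy (i : bool) (sigma : seq A -> A) : Prop :=
  forall (v0 : A) (s : seq A),
    owner (last v0 s) = i -> edge (last v0 s) (sigma (v0 :: s)).

Definition consistent (i : bool) (sigma : seq A -> A) (rho : nat -> A) : Prop :=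
  forall j : nat, owner (rho j) = i -> rho j.+1 = sigma (mkseq rho j.+1).

Definition strategy_value1 (K : pred (seq C)) (tau : seq A -> A) (v : A)
    : enat :=
  infimum \top
    [set play_value K rho | rho in
       [set rho | [/\ is_play rho, rho 0 = v & consistent true tau rho]]]%classic.

End Games.

Section Product.
Context {C : finType} (A : arena C) (D : dfa C).

Definition init (v : A) : D := delta (start D) (color v).

Definition prod_edge (x y : A * D) : bool :=
  edge x.1 y.1 && (y.2 == delta x.2 (color y.1)).

Fact prod_edge_serial (x : A * D) : exists y, prod_edge x y.
Proof.
have [v' xv'] := edge_serial x.1.
by exists (v', delta x.2 (color v')); rewrite /prod_edge xv' eqxx.
Qed.

Definition product_arena : arena C :=
  @Arena C (A * D)%type (fun x => owner x.1) prod_edge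
    (fun x y => weight x.1 y.1) (fun x => color x.1) prod_edge_serial.

Definition accepting : {set product_arena} :=
  [set x : A * D | x.2 \in final D].

Definition ext_step (x : A * D) (v' : A) : A * D :=
  (v', delta x.2 (color v')).

Definition extension (v0 : A) (s : seq A) : seq product_arena :=
  (v0, init v0) :: scanl ext_step (v0, init v0) s.

End Product.

Section Rankings.
(* [F] stands for the accepting vertices, [F'] for an arbitrary set.          *)
Context {C : finType} (V : arena C).

Definition ranking := {ffun V -> enat}.

Definition one_step (r : ranking) (v : V) : enat :=
  if owner v then \big[Order.max / \bot]_(v' | edge v v') add_enat (weight v v') (r v')
  else \big[Order.min / \top]_(v' | edge v v') add_enat (weight v v') (r v').

Definition ell (F' : {set V}) (r : ranking) : ranking :=
  [ffun v => if v \in F' then \bot else Order.min (r v) (one_step r v)].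

Definition ell_fix (F' : {set V}) : ranking :=
  stationary (ell F') [ffun => \top].

Definition cmplt (F' : {set V}) (r : ranking) : ranking :=
  [ffun v => if v \in F' then one_step r v else r v].

Context (F : {set V}).

(* The distinct values of [r] on [F] in increasing order; the index [h] of    *)
(* the definitions below ranges over 1, ..., [nvals r].                       *)
Definition vals (r : ranking) : seq enat :=
  sort <=%O (undup [seq r v | v in F]).

Definition nvals (r : ranking) : nat := size (vals r).

Definition val_at (r : ranking) (h : nat) : enat := nth \top (vals r) h.-1.

Definition F_at (r : ranking) (h : nat) : {set V} :=
  [set v in F | r v <= val_at r h].

Definition r1_at (r : ranking) (h : nat) : ranking := ell_fix (F_at r h).

Definition r2_at (r : ranking) (h : nat) : ranking :=
  cmplt (F_at r h) (r1_at r h).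

Definition ell_L (r : ranking) : ranking :=
  [ffun v => \big[Order.min / \top]_(1 <= h < (nvals r).+1)
               Order.max (r v) (Order.max (r2_at r h v) (val_at r h))].

Definition optimal (r : ranking) (h : nat) (v u : V) : Prop :=
  edge v u /\ r2_at r h v = add_enat (weight v u) (r1_at r h u).

Definition rank_seq (j : nat) : ranking := iter j ell_L [ffun => \bot].

Definition rstar : ranking := stationary ell_L [ffun => \bot].

Definition settling_time (v : V) : nat :=
  least [set j | rank_seq j v = rstar v]%classic.

Definition pre_rank (v : V) : ranking := rank_seq (settling_time v).-1.

Definition type_zero (v : V) : bool := rstar v == \bot.

Definition hits (v : V) (h : nat) : bool := rstar v == r2_at (pre_rank v) h v.

Definition type_one (v : V) : bool :=
  ~~ type_zero v && has (hits v) (iota 1 (nvals (pre_rank v))).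

Definition type_two (v : V) : bool := ~~ type_zero v && ~~ type_one v.

(* Only meaningful if [v] is of type one or two; in the latter case it is the *)
(* 1-based position of [rstar v] in the strictly increasing sequence          *)
(* [vals (pre_rank v)].                                                       *)
Definition h_of (v : V) : nat :=
  if type_one v then
    (\max_(1 <= h < (nvals (pre_rank v)).+1 | hits v h) h)%N
  else (index (rstar v) (vals (pre_rank v))).+1.

(* [sigma v' v] is the move at the current vertex [v'] with memory state [v]. *)
(* Nothing but being a successor is required of the arbitrary choices.        *)
Definition tau'_spec (sigma : V -> V -> V) : Prop :=
  forall v' v : V, owner v' = true ->
    [/\ edge v' (sigma v' v),
        type_one v -> optimal (pre_rank v) (h_of v) v' (sigma v' v)
      & type_two v -> (1 < h_of v)%N ->
          optimal (pre_rank v) (h_of v).-1 v' (sigma v' v)].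

Definition memory_update (m v' : V) : V := if v' \in F then v' else m.

(* The memory state after the path [v0 :: s].                                 *)
Definition memory (v0 : V) (s : seq V) : V := foldl memory_update v0 s.

End Rankings.

Section Tau.
Context {C : finType} (A : arena C) (D : dfa C).

Definition move_of (sigma : A * D -> A * D -> A * D) (v0 : A) (s : seq A) : A :=
  let e := extension D v0 s in
  let x0 : product_arena A D := (v0, init D v0) in
  (sigma (last x0 (behead e)) (memory (accepting A D) x0 (behead e))).1.

(* [tau] is one of the strategies obtained by fixing the arbitrary choices.   *)
Definition is_tau (tau : seq A -> A) : Prop :=
  is_strategy true tau /\
  (accepting A D <> finset.set0 ->
   exists2 sigma, tau'_spec (accepting A D) sigma &
     forall (v0 : A) (s : seq A), owner (last v0 s) = true ->
       tau (v0 :: s) = move_of sigma v0 s).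

End Tau.

(* Main.v *)
(* Consider a play of the product arena consistent with [tau'] and a position *)
(* [p] whose vertex [v] is the memory state. At the first later visit to [F], *)
(* in [u] say, either the cost since [p] is at least [rstar v], so that [p]   *)
(* witnesses the bound for the supremum, or [u] has rank at least [rstar v]   *)
(* one iteration before [v] settles. In the latter case the argument restarts *)
(* from [u]: either [rstar u > rstar v], or [rstar u = rstar v] and [u]       *)
(* settles strictly earlier than [v], so this can only happen finitely often. *)

Require Import Defs.
From mathcomp Require Import all_boot all_order.
From mathcomp Require Import boolp classical_sets.

Set Implicit Arguments.
Unset Strict Implicit.
Unset Printing Implicit Defensive.

Import Order.TTheory.

Local Open Scope nat_scope.
Local Open Scope order_scope.

(** Fix [v] with [rstar F v] nonzero. [tau'_guarantee] attaches to it a set [F']: [F_at] at [h_of v]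
    for type one, at [(h_of v).-1] for type two, and the empty set for type two with [h_of v = 1].
    When [F'] is nonempty, the moves of [tau'] under memory [v] force a cost of at least [rstar F v]
    before [F'] is reached. This is a potential argument ([cmplt_le_infix_weight]): at each step the
    potential drops by at most the weight of the edge taken, and it vanishes on [F']. The choice of
    [h_of v] ensures that accepting vertices outside [F'] already have value at least [rstar F v] in
    [pre_rank F v].

    [tau'_value] follows the play to the first later accepting vertex. If it lies in [F'],
    nonnegative weights carry the bound to all later accepting positions; otherwise the argument
    restarts there, and [progress] bounds the number of restarts. The position finally reached gives
    a large enough term of the supremum in [play_value]; the section [Extension] transfers this from
    the product arena to [A]. *)

Section Enat.

(** * Extrema in the naturals and extended naturals *)

Lemma nat_set_min (P : set nat) : (P !=set0)%classic ->
  exists2 n, P n & forall m, P m -> (n <= m)%N.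
Proof.
case=> k Pk.
have exP : exists n, `[< P n >] by exists k; apply/asboolP.
case: (ex_minnP exP) => n /asboolP Pn min_n.
by exists n => // m Pm; apply/min_n/asboolP.
Qed.

Lemma leastP (P : set nat) : (P !=set0)%classic ->
  P (least P) /\ forall m, P m -> (least P <= m)%N.
Proof.
move=> P0; have [n Pn min_n] := nat_set_min P0.
suff -> : least P = n by [].
rewrite /least /infimum ifF; last first.
  by apply/negbTE/set0P.
case: xgetP => [y _ infy|/(_ n) []]; first apply: (is_subset1_infimums infy).
all: split=> [m /min_n //|m]; exact.
Qed.

Lemma enat_set_min (P : set enat) : (P !=set0)%classic ->
  exists2 x, P x & forall y, P y -> x <= y.
Proof.
case: (pselect (exists n, P (Some n))) => [[k Pk] _|noP [[n|] Px]].
- have [|n Pn min_n] := @nat_set_min [set n | P (Some n)]%classic.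
    by exists k.
  by exists (Some n) => // -[m /min_n|_] //; apply: le0_enat.
- by case: noP; exists n.
- by exists None => // -[n Pn|//]; case: noP; exists n.
Qed.

(** The supremum exists: the upper bounds contain [\top], and the order is well-founded. *)
Lemma le_enat_supremum (P : set enat) (x : enat) : P x -> x <= supremum \bot P.
Proof.
apply: ge_supremum_Nmem.
have [|s ubs min_s] := @enat_set_min (ubound P).
  by exists \top => y _; apply: lex1.
by exists s.
Qed.

Lemma le_infimum_top (P : set enat) (x : enat) :
  (forall y, P y -> x <= y) -> x <= infimum \top P.
Proof.
move=> xP; rewrite /infimum; case: ifP => _; first exact: lex1.
(* If no infimum is found, the default is [\top] and the bound is trivial. *)
by case: xgetP => [y _ [_]|_]; [apply | apply: lex1].
Qed.

Lemma le_add_enat (m : nat) (x y : enat) :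
  x <= y -> add_enat m x <= add_enat m y.
Proof. by case: x y => [x|] [y|] //; rewrite /Order.le /= leq_add2l. Qed.

Lemma nonincreasing_enat_stable (u : nat -> enat) :
  (forall i j, (i <= j)%N -> u j <= u i) ->
  exists N, forall n, (N <= n)%N -> u n = u N.
Proof.
move=> mono_u; have [|_ [N _ <-] minN] := @enat_set_min (range u).
  by exists (u 0); exists 0.
exists N => n leNn; apply/le_anti; rewrite mono_u //=.
by apply: minN; exists n.
Qed.

End Enat.

(** * Iteration until stationarity *)

Section Stationary.

Lemma stationary_iter (T : Type) (f : T -> T) (x : T) :
  exists n, stationary f x = iter n f x.
Proof. by eexists. Qed.

Lemma stationaryP (T : Type) (f : T -> T) (x : T) :
  (exists n, iter n f x = iter n.+1 f x) ->
  f (stationary f x) = stationary f x.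
Proof.
move=> stop.
by have [] := @leastP [set n | iter n f x = iter n.+1 f x]%classic stop.
Qed.

End Stationary.

(** * Reachability rankings: [ell_fix], [cmplt] and the cost of a play *)

Section Rankings.
Context {C : finType} {V : arena C}.
Implicit Types (v u : V) (r : ranking V) (F : {set V}).

Lemma one_step_mono r1 r2 v : (forall u, r1 u <= r2 u) ->
  one_step r1 v <= one_step r2 v.
Proof.
move=> le12; rewrite /one_step; case: (owner v).
  by apply: le_bigmax2 => u _; apply: le_add_enat.
by apply: le_bigmin2 => u _; apply: le_add_enat.
Qed.

Lemma ell_mono F1 F2 r1 r2 v : F1 \subset F2 -> (forall u, r1 u <= r2 u) ->
  ell F2 r1 v <= ell F1 r2 v.
Proof.
move=> sF le12; rewrite !ffunE; case: ifP => [_|vF2]; first exact: le0x.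
rewrite ifF; last by apply: contraFF vF2 => /(fintype.subsetP sF).
by apply: le_min2 => //; apply: one_step_mono.
Qed.

Lemma ell_le F r v : ell F r v <= r v.
Proof. by rewrite ffunE; case: ifP => _; rewrite ?le0x ?ge_min ?lexx. Qed.

Definition ell_iter F n : ranking V := iter n (ell F) [ffun => \top].

Lemma ell_fix_ell_iter F : exists n, ell_fix F = ell_iter F n.
Proof. exact: stationary_iter. Qed.

Lemma ell_iter_nonincreasing F v i j :
  (i <= j)%N -> ell_iter F j v <= ell_iter F i v.
Proof.
move=> /subnK <-; elim: (j - i)%N => //= k; apply: le_trans; exact: ell_le.
Qed.

Lemma ell_fix_fixed F : ell F (ell_fix F) = ell_fix F.
Proof.
apply: stationaryP.
have stab v := cid (nonincreasing_enat_stable (@ell_iter_nonincreasing F v)).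
(* Each vertex stabilizes separately; finiteness of [V] gives a common bound. *)
exists (\max_v sval (stab v))%N; apply/ffunP => v.
have leN : (sval (stab v) <= \max_u sval (stab u))%N by apply: leq_bigmax.
have st := svalP (stab v).
by rewrite (st _ leN); apply/esym/(st _.+1)/(leq_trans leN).
Qed.

Lemma ell_fix_in F v : v \in F -> ell_fix F v = \bot.
Proof. by move=> vF; rewrite -ell_fix_fixed ffunE vF. Qed.

Lemma ell_fix_le_iter F n v : ell_fix F v <= ell_iter F n v.
Proof.
elim: n v => [|n IHn] v; first by rewrite ffunE lex1.
by rewrite -ell_fix_fixed; apply: ell_mono.
Qed.

Lemma ell_fix_antitone F1 F2 v : F1 \subset F2 -> ell_fix F2 v <= ell_fix F1 v.
Proof.
move=> sF; have [n ->] := ell_fix_ell_iter F1.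
apply: le_trans (ell_fix_le_iter F2 n v) _.
by elim: n v => //= n IHn v; apply: ell_mono.
Qed.

(** The iterates decrease, so off [F] each new value is a one-step value of an earlier, larger
    iterate, and the minimum with [r v] in [ell] never binds. *)
Lemma one_step_ell_iter F n v : v \notin F ->
  one_step (ell_iter F n) v <= ell_iter F n v.
Proof.
move=> vF; elim: n => [|n IHn]; first by rewrite ffunE lex1.
rewrite /= ffunE (negbTE vF) (min_idPr IHn).
by apply: one_step_mono => u; apply: ell_le.
Qed.

(** Both cases of [cmplt] thus agree: it measures the cost of reaching [F] by at least one move,
    even from inside [F]. *)
Lemma cmplt_ell_fix F v : cmplt F (ell_fix F) v = one_step (ell_fix F) v.
Proof.
rewrite ffunE; case: ifPn => // vF; apply/le_anti/andP; split.
  by rewrite -{1}ell_fix_fixed ffunE (negbTE vF) ge_min lexx orbT.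
have [n ->] := ell_fix_ell_iter F.
exact: one_step_ell_iter.
Qed.

Lemma cmplt_antitone F1 F2 v : F1 \subset F2 ->
  cmplt F2 (ell_fix F2) v <= cmplt F1 (ell_fix F1) v.
Proof.
move=> sF; rewrite !cmplt_ell_fix; apply: one_step_mono => u.
exact: ell_fix_antitone.
Qed.

Lemma cmplt_ell_fix_step F v u : edge v u ->
  (owner v ->
     cmplt F (ell_fix F) v = add_enat (weight v u) (ell_fix F u)) ->
  cmplt F (ell_fix F) v <= add_enat (weight v u) (ell_fix F u).
Proof.
move=> vu; case own: (owner v) => opt; first by rewrite opt.
by rewrite cmplt_ell_fix /one_step own; apply: bigmin_le_cond.
Qed.

Lemma infix_weight_recl (x : nat -> V) p i : (p < i)%N ->
  infix_weight x p i = (weight (x p) (x p.+1) + infix_weight x p.+1 i)%N.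
Proof. by move=> ltpi; rewrite /infix_weight big_ltn. Qed.

Lemma leq_infix_weight (x : nat -> V) p i j : (p <= i)%N -> (i <= j)%N ->
  (infix_weight x p i <= infix_weight x p j)%N.
Proof.
by move=> pi ij; rewrite /infix_weight (big_cat_nat pi ij) /= leq_addr.
Qed.

Lemma cmplt_le_infix_weight F (x : nat -> V) p i : (p < i)%N ->
  (forall k, (p < k < i)%N -> x k \notin F) -> x i \in F ->
  (forall k, (p <= k < i)%N -> edge (x k) (x k.+1)) ->
  (forall k, (p <= k < i)%N -> owner (x k) ->
     cmplt F (ell_fix F) (x k) =
     add_enat (weight (x k) (x k.+1)) (ell_fix F (x k.+1))) ->
  cmplt F (ell_fix F) (x p) <= Some (infix_weight x p i).
Proof.
move=> ltpi; have [n ->] : exists n, i = (p + n.+1)%N.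
  by exists (i - p).-1; rewrite prednK ?subn_gt0 // subnKC // ltnW.
elim: n p {ltpi} => [|n IHn] p xF xiF xE xopt.
  have pp : (p <= p < p + 1)%N by rewrite leqnn addn1 ltnS leqnn.
  apply: le_trans (cmplt_ell_fix_step (xE _ pp) (xopt _ pp)) _.
  rewrite addn1 in xiF *.
  by rewrite ell_fix_in // infix_weight_recl // /infix_weight big_geq.
have lt_p : (p < p + n.+2)%N by rewrite -ltn_subLR // subnn.
have pp : (p <= p < p + n.+2)%N by rewrite leqnn.
apply: le_trans (cmplt_ell_fix_step (xE _ pp) (xopt _ pp)) _.
rewrite infix_weight_recl //.
have : ell_fix F (x p.+1) <= Some (infix_weight x p.+1 (p + n.+2)).
  (* Strictly between [p] and [i] the play is off [F], where [cmplt] changes nothing. *)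
  have -> : ell_fix F (x p.+1) = cmplt F (ell_fix F) (x p.+1).
    by rewrite ffunE ifN // xF // ltnSn addnS ltnS addnS ltnS leq_addr.
  rewrite -addSnnS; apply: IHn => [k||k|k]; rewrite addSnnS //.
  - by move=> /andP[lepk ki]; apply: xF; rewrite ki (ltn_trans _ lepk).
  - by move=> /andP[lepk ki]; apply: xE; rewrite ki (ltnW lepk).
  - by move=> /andP[lepk ki]; apply: xopt; rewrite ki (ltnW lepk).
by move/(le_add_enat (weight (x p) (x p.+1))).
Qed.

End Rankings.

(** * The limit ranking [rstar], settling times, types and the strategy [tau'] *)

Section Limit.
Context {C : finType} {V : arena C} (F : {set V}).
Implicit Types (v u : V) (r : ranking V).

Lemma vals_sorted r : sorted <%O (vals F r).
Proof. by rewrite sort_lt_sorted undup_uniq. Qed.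

Lemma mem_vals r u : u \in F -> r u \in vals F r.
Proof.
by move=> uF; rewrite mem_sort mem_undup; apply: fintype.image_f.
Qed.

Lemma val_at1_le r u : u \in F -> val_at F r 1 <= r u.
Proof.
move=> /(mem_vals r) /(nthP \top) [i lti <-].
rewrite /val_at (lt_sorted_leq_nth _ (vals_sorted r)) ?inE //.
exact: leq_ltn_trans lti.
Qed.

Lemma notin_F_at r h u : (0 < h)%N -> u \in F -> u \notin F_at F r h ->
  (h < nvals F r)%N /\ val_at F r h.+1 <= r u.
Proof.
move=> h0 uF; rewrite inE uF -ltNge /= /val_at.
have /(nthP \top) [i lti <-] := mem_vals r uF.
have [leh|lth] := leqP (nvals F r) h.-1.
  (* Out of range, [val_at] is [\top], which no value exceeds. *)
  by rewrite nth_default // lt1x.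
move=> lt_val.
have lehi : (h <= i)%N.
  by rewrite -(prednK h0) -(lt_sorted_ltn_nth \top (vals_sorted r)) ?inE.
have lthn : (h < nvals F r)%N by exact: leq_ltn_trans lti.
by rewrite (lt_sorted_leq_nth \top (vals_sorted r)) ?inE.
Qed.

Lemma sub_F_at r h : (0 < h)%N -> (h < nvals F r)%N ->
  F_at F r h \subset F_at F r h.+1.
Proof.
move=> h0 ltn; apply/fintype.subsetP => u; rewrite !inE.
move=> /andP[-> /= /le_trans]; apply.
rewrite (lt_sorted_leq_nth \top (vals_sorted r)) ?inE ?leq_pred //=.
exact: leq_ltn_trans (leq_pred _) ltn.
Qed.

Lemma rank_seq_mono i j v :
  (i <= j)%N -> rank_seq F i v <= rank_seq F j v.
Proof.
move=> /subnK <-; elim: (j - i)%N => //= k /le_trans; apply.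
rewrite /rank_seq /= [X in _ <= X]ffunE.
by apply: le_bigmin => [|h _]; rewrite ?lex1 // le_max lexx.
Qed.

Lemma rstar_rank_seq : exists n, rstar F = rank_seq F n.
Proof. exact: stationary_iter. Qed.

(* If the iteration never became stationary, [rstar] would be its junk value, *)
(* which is the constant [\bot]; so termination need not be proved.           *)
Lemma rstar_fixed v : rstar F v != \bot -> ell_L F (rstar F) = rstar F.
Proof.
move=> vnz; apply: stationaryP; apply: contrapT => nonstop.
move/eqP: vnz; apply; rewrite /rstar /stationary /least.
suff -> : [set n | iter n (ell_L F) [ffun => \bot]
                   = iter n.+1 (ell_L F) [ffun => \bot]]%classic = set0.
  by rewrite /infimum eqxx ffunE.
by apply/eqP; apply: contra_notT nonstop => /set0P.
Qed.

Lemma rank_seq_le_rstar v j u : rstar F v != \bot ->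
  rank_seq F j u <= rstar F u.
Proof.
move=> vnz; have [n rE] := rstar_rank_seq.
have rfix k : rank_seq F (k + n) = rstar F.
  by elim: k => [|k IHk] //; rewrite addSn /= IHk (rstar_fixed vnz).
by rewrite -(rfix j); apply: rank_seq_mono; apply: leq_addr.
Qed.

Lemma settling_timeP v :
  rank_seq F (settling_time F v) v = rstar F v /\
  forall j, rank_seq F j v = rstar F v -> (settling_time F v <= j)%N.
Proof.
have [n rE] := rstar_rank_seq.
apply: (@leastP [set j | rank_seq F j v = rstar F v]%classic).
by exists n => /=; rewrite rE.
Qed.

Lemma settling_time_gt0 v : rstar F v != \bot -> (0 < settling_time F v)%N.
Proof.
case: posnP => // t0; have [] := settling_timeP v.
by rewrite t0 ffunE => <-; rewrite eqxx.
Qed.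

Lemma rstar_pre_rank v : rstar F v != \bot ->
  rstar F v = ell_L F (pre_rank F v) v.
Proof.
move=> vnz; have [<- _] := settling_timeP v.
by rewrite -[in LHS](prednK (settling_time_gt0 vnz)).
Qed.

Lemma pre_rank_lt v : rstar F v != \bot -> pre_rank F v v < rstar F v.
Proof.
move=> vnz; rewrite lt_neqAle (rank_seq_le_rstar _ _ vnz) andbT.
apply/eqP => /(proj2 (settling_timeP v)).
by rewrite leqNgt ltn_predL settling_time_gt0.
Qed.

Lemma rstar_le_max v h : rstar F v != \bot ->
  (0 < h <= nvals F (pre_rank F v))%N ->
  rstar F v <= Order.max (r2_at F (pre_rank F v) h v)
                         (val_at F (pre_rank F v) h).
Proof.
move=> vnz hP; set m := Order.max _ _.
have : rstar F v <= Order.max (pre_rank F v v) m.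
  rewrite rstar_pre_rank // ffunE; apply: bigmin_inf_seq (lexx _) => //.
  by rewrite mem_index_iota ltnS.
by rewrite le_max leNgt pre_rank_lt.
Qed.

(** [pre_rank F v] is the iterate just before [v] settles; if its value at [u] is already
    [rstar F u], then [u] has settled by then. *)
Lemma progress v u : rstar F v != \bot -> rstar F v <= pre_rank F v u ->
  rstar F v <= rstar F u /\
  (rstar F v = rstar F u -> (settling_time F u < settling_time F v)%N).
Proof.
move=> vnz le_vu; have le_u := rank_seq_le_rstar (settling_time F v).-1 u vnz.
split=> [|eq_vu]; first exact: le_trans le_u.
rewrite -(prednK (settling_time_gt0 vnz)) ltnS.
apply: (proj2 (settling_timeP u)); apply: le_anti.
by rewrite le_u -eq_vu.
Qed.

Lemma bigmaxn_attained (P : pred nat) n : has P (iota 1 n) ->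
  let h := (\max_(1 <= i < n.+1 | P i) i)%N in P h /\ (0 < h <= n)%N.
Proof.
elim: n => // n IHn; rewrite -[n.+1]addn1 iotaD has_cat /= orbF add1n addn1.
rewrite big_mkcond big_nat_recr //= -big_mkcond /=.
case PSn: (P n.+1).
  move=> _.
  suff -> : maxn (\max_(1 <= i < n.+1 | P i) i) n.+1 = n.+1.
    by rewrite PSn leqnn.
  apply/maxn_idPr/bigmax_leqP_seq => i.
  rewrite mem_index_iota => /andP[_ lti] _.
  exact: ltnW.
by rewrite orbF maxn0 => /IHn [Ph /andP[-> /leqW ->]].
Qed.

(** Type two excludes equality with every [r2_at]. If [rstar F v] were no value either, every
    maximum would exceed it strictly, and so would their minimum. *)
Lemma type_two_mem_vals v f : f \in F -> type_two F v ->
  rstar F v \in vals F (pre_rank F v).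
Proof.
move=> fF /andP[vnz]; rewrite /type_one vnz /= => /hasPn nohit.
apply: contraT => notval.
have rstar_lt h : (0 < h <= nvals F (pre_rank F v))%N ->
    rstar F v < Order.max (r2_at F (pre_rank F v) h v)
                          (val_at F (pre_rank F v) h).
  move=> hP; have := rstar_le_max vnz hP.
  rewrite le_eqVlt => /orP[/eqP eq_m|//].
  have /andP[h0 hn] := hP.
  have nhit : ~~ hits F v h by apply: nohit; rewrite mem_iota h0 add1n ltnS.
  move: eq_m; rewrite maxElt; case: ifP => _ /eqP eq_m.
    by move: notval; rewrite (eqP eq_m) mem_nth // prednK.
  by rewrite /hits eq_m in nhit.
have n0 : (0 < nvals F (pre_rank F v))%N.
  by have := mem_vals (pre_rank F v) fF; rewrite /nvals; case: (vals _ _).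
suff : rstar F v < rstar F v by rewrite ltxx.
rewrite [X in _ < X]rstar_pre_rank // ffunE big_nat.
apply: lt_bigmin => [|h hP].
  (* The default [\top] of the minimum must exceed [rstar F v] too; the index 1, available as [F] is
     nonempty, shows this. *)
  by apply: lt_le_trans (lex1 _); apply: (rstar_lt 1%N); rewrite n0.
by rewrite lt_max rstar_lt ?orbT.
Qed.


Lemma h_of_type_one v : type_one F v ->
  [/\ hits F v (h_of F v), (0 < h_of F v <= nvals F (pre_rank F v))%N
    & forall h, (h_of F v < h <= nvals F (pre_rank F v))%N -> ~~ hits F v h].
Proof.
move=> t1; rewrite /h_of t1.
have /andP[_ /bigmaxn_attained /= [hit hP]] := t1; split=> // h /andP[lth len].
apply: contraL (lth) => hith; rewrite -leqNgt; apply: leq_bigmax_seq => //.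
by rewrite mem_index_iota ltnS len andbT (leq_ltn_trans (leq0n _) lth).
Qed.

(* [F'] is the set that [sigma] keeps away from when the memory is [v]: its   *)
(* vertices are reached only at cost [rstar F v], while the other vertices of *)
(* [F] are at least as good for Player 1 as [v] already one iteration before  *)
(* [v] settles.                                                               *)
Lemma tau'_guarantee (sigma : V -> V -> V) v f :
  tau'_spec F sigma -> f \in F -> rstar F v != \bot ->
  exists2 F' : {set V},
    forall u, u \in F -> u \notin F' -> rstar F v <= pre_rank F v u
  & F' != finset.set0 ->
    [/\ F' \subset F, rstar F v <= cmplt F' (ell_fix F') v
      & forall u, owner u ->
          cmplt F' (ell_fix F') u =
          add_enat (weight u (sigma u v)) (ell_fix F' (sigma u v))].
Proof.
move=> specP fF vnz; set r := pre_rank F v.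
have subF h : F_at F r h \subset F.
  by apply/fintype.subsetP => u; rewrite inE => /andP[].
have [t1|nt1] := boolP (type_one F v).
  have [hit /andP[h0 hn] max_h] := h_of_type_one t1.
  exists (F_at F r (h_of F v)) => [u uF notu|_].
    have [lth le_u] := notin_F_at h0 uF notu.
    (* By antitonicity [r2_at] at the next index is at most [rstar F v]; equality would contradict
       the maximality of [h_of F v], so the next value must carry the bound. *)
    have := @rstar_le_max _ (h_of F v).+1 vnz lth.
    rewrite le_max => /orP[le_r2|/le_trans]; last exact.
    have /negP[] : ~~ hits F v (h_of F v).+1 by apply: max_h; rewrite leqnn.
    rewrite /hits eq_le le_r2 (eqP hit).
    exact/cmplt_antitone/sub_F_at.
  split=> [||u own_u]; [exact: subF|by rewrite (eqP hit)|].
  by have [_ /(_ t1) [] ] := specP u v own_u.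
have t2 : type_two F v by rewrite /type_two nt1 andbT.
have vmem := type_two_mem_vals fF t2.
have hE : h_of F v = (index (rstar F v) (vals F r)).+1.
  by rewrite /h_of (negbTE nt1).
have lti : (index (rstar F v) (vals F r) < nvals F r)%N by rewrite index_mem.
have nthi : val_at F r (h_of F v) = rstar F v by rewrite hE /val_at nth_index.
case: (posnP (h_of F v).-1) => [i0|h0].
  (* Here [rstar F v] is the least value on [F], so every accepting vertex is good enough. *)
  exists finset.set0 => [u uF _|]; last by rewrite eqxx.
  by rewrite -nthi hE; rewrite hE /= in i0; rewrite i0 val_at1_le.
have hgt1 : (1 < h_of F v)%N by rewrite -ltn_predRL.
exists (F_at F r (h_of F v).-1) => [u uF notu|_].
  by have [_] := notin_F_at h0 uF notu; rewrite (ltn_predK hgt1) nthi.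
split=> [||u own_u]; first exact: subF; last first.
  by have [_ _ /(_ t2 hgt1) []] := specP u v own_u.
have hP : (0 < (h_of F v).-1 <= nvals F r)%N by rewrite h0 hE ltnW.
(* The value at the preceding index is below [rstar F v], so [r2_at] must account for the bound. *)
have := rstar_le_max vnz hP; rewrite le_max => /orP[//|].
rewrite leNgt -{1}nthi /val_at (lt_sorted_ltn_nth \top (vals_sorted r)) ?inE //.
- by rewrite ltn_predL h0.
- by rewrite (leq_ltn_trans (leq_pred _)) // hE.
- by rewrite hE.
Qed.

Lemma tau'_value (sigma : V -> V -> V) (x m : nat -> V) f :
  f \in F -> tau'_spec F sigma -> is_play x ->
  (forall i, m i.+1 = memory_update F (m i) (x i.+1)) ->
  (forall i, owner (x i) -> x i.+1 = sigma (x i) (m i)) ->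
  forall p, m p = x p -> exists p', forall j, (p' < j)%N -> x j \in F ->
    rstar F (x p) <= Some (infix_weight x p' j).
Proof.
move=> fF specP playx mS xS p.
(* Lexicographic induction: first on the number of vertices of larger rank, then on the settling
   time. *)
have [n] := ubnP #|[set u | rstar F (x p) < rstar F u]|.
elim: n p => // n IHn p; have [t] := ubnP (settling_time F (x p)).
elim: t p => // t IHt p lt_t lt_n mp.
have [/eqP ->|vnz] := boolP (rstar F (x p) == \bot).
  by exists p => j _ _; apply: le0x.
have [F' guard guide] := tau'_guarantee specP fF vnz.
case: (pselect (exists i, (p < i)%N && (x i \in F)))
  => [visits|noF]; last first.
  by exists p => j ltpj xjF; case: noF; exists j; rewrite ltpj.
case: (ex_minnP visits) => i /andP[ltpi xiF] min_i.
have notF k : (p < k < i)%N -> x k \notin F.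
  case/andP=> ltpk; apply: contraL => xkF; rewrite -leqNgt min_i //.
  by rewrite ltpk.
(* Without visits to [F] the memory stays at [x p], so all moves up to [i] follow the same [F']. *)
have mem k : (p <= k < i)%N -> m k = x p.
  move=> /andP[/subnK <-]; elim: (k - p)%N => // d IHd ltd.
  rewrite addSn mS /memory_update ifN; first by apply: IHd; apply: ltnW.
  by rewrite -addSn notF // addSn ltnS leq_addl.
have mi : m i = x i.
  by rewrite -(prednK (leq_ltn_trans (leq0n p) ltpi)) mS /memory_update
     (prednK (leq_ltn_trans (leq0n p) ltpi)) xiF.
have [xiF'|xiF'] := boolP (x i \in F').
  have [|subF' le_v opt] := guide.
    by apply/set0Pn; exists (x i).
  exists p => j ltpj xjF; apply: le_trans le_v _.
  apply: (@le_trans _ enat (Some (infix_weight x p i))); last first.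
    by apply: leq_infix_weight; rewrite ?(ltnW ltpi) // min_i // ltpj.
  apply: cmplt_le_infix_weight => // k kP.
    by apply: contra (notF k kP) => /(fintype.subsetP subF').
  by move=> own_k; rewrite [x k.+1]xS // mem // opt.
have [le_vi lt_t_i] := progress vnz (guard _ xiF xiF').
suff [p' bound] : exists p', forall j, (p' < j)%N -> x j \in F ->
    rstar F (x i) <= Some (infix_weight x p' j).
  by exists p' => j ltj xjF; apply: le_trans le_vi _; apply: bound.
move: le_vi; rewrite le_eqVlt => /orP[/eqP eq_vi|lt_vi].
  apply: IHt => //; last by rewrite -eq_vi.
  by apply: leq_trans (lt_t_i eq_vi) _; rewrite -ltnS.
apply: IHn => //; rewrite -ltnS; apply: leq_trans lt_n; rewrite ltnS.
apply: proper_card; apply/properP; split.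
  by apply/fintype.subsetP => u; rewrite !inE; apply: lt_trans.
by exists (x i); rewrite !inE ?ltxx.
Qed.

End Limit.

(** * Plays of [A] as plays of the product arena *)

Section Extension.
Context {C : finType} (A : arena C) (D : dfa C).

Fixpoint ext_play (rho : nat -> A) (i : nat) : product_arena A D :=
  if i is k.+1 then ext_step (ext_play rho k) (rho k.+1)
  else (rho 0, init D (rho 0)).

Fixpoint ext_memory (rho : nat -> A) (i : nat) : product_arena A D :=
  if i is k.+1
  then memory_update (accepting A D) (ext_memory rho k) (ext_play rho k.+1)
  else ext_play rho 0.

Lemma ext_play1 rho i : (ext_play rho i).1 = rho i.
Proof. by case: i. Qed.

Lemma ext_play2 rho i :
  (ext_play rho i).2 =
  foldl (@delta C D) (start D) [seq color u | u <- mkseq rho i.+1].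
Proof.
elim: i => // i IHi.
by rewrite mkseqS map_rcons foldl_rcons -IHi.
Qed.

Lemma mem_accepting_ext_play rho i :
  (ext_play rho i \in accepting A D) =
  dfa_lang D [seq color u | u <- mkseq rho i.+1].
Proof. by rewrite inE ext_play2. Qed.

Lemma is_play_ext_play rho : is_play rho -> is_play (ext_play rho).
Proof.
move=> playr i; rewrite /= /prod_edge /= !ext_play1 eqxx andbT; exact: playr.
Qed.

Lemma infix_weight_ext_play rho i j :
  infix_weight (ext_play rho) i j = infix_weight rho i j.
Proof. by apply: eq_bigr => k _; rewrite /= ext_play1. Qed.

Lemma mkseq_recl (T : Type) (g : nat -> T) n :
  mkseq g n.+1 = g 0 :: mkseq (fun i => g i.+1) n.
Proof. by rewrite /mkseq /= (iotaDl 1 0 n) -map_comp. Qed.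

Lemma foldl_ext_step rho n :
  foldl (@ext_step C A D) (rho 0, init D (rho 0))
    (mkseq (fun i => rho i.+1) n) = ext_play rho n.
Proof. by elim: n => // n IHn; rewrite mkseqS foldl_rcons IHn. Qed.

Lemma behead_extension rho n :
  behead (extension D (rho 0) (mkseq (fun i => rho i.+1) n)) =
  mkseq (fun i => ext_play rho i.+1) n.
Proof.
rewrite /extension /=; elim: n => // n IHn.
by rewrite !mkseqS scanl_rcons IHn foldl_rcons foldl_ext_step.
Qed.

Lemma memory_ext_play rho n :
  memory (accepting A D) (ext_play rho 0)
    (mkseq (fun i => ext_play rho i.+1) n) = ext_memory rho n.
Proof.
by rewrite /memory; elim: n => // n IHn; rewrite mkseqS foldl_rcons IHn.
Qed.

Lemma move_of_play sigma rho n :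
  move_of sigma (rho 0) (mkseq (fun i => rho i.+1) n) =
  (sigma (ext_play rho n) (ext_memory rho n)).1.
Proof.
rewrite /move_of behead_extension -memory_ext_play; congr (sigma _ _).1.
by case: n => // n; rewrite mkseqS last_rcons.
Qed.

(** [tau] fixes only the [A]-component of the move; the automaton state agrees because [sigma] moves
    along a product edge. *)
Lemma ext_play_consistent tau sigma rho :
  tau'_spec (accepting A D) sigma ->
  (forall (v0 : A) (s : seq A), owner (last v0 s) = true ->
     tau (v0 :: s) = move_of sigma v0 s) ->
  consistent true tau rho ->
  forall i, owner (ext_play rho i) ->
    ext_play rho i.+1 = sigma (ext_play rho i) (ext_memory rho i).
Proof.
move=> specP tauE cons i own_i.
have [/andP[_ /eqP eq2] _ _] := specP _ (ext_memory rho i) own_i.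
have own_r : owner (rho i) by rewrite -(ext_play1 rho i).
have last_r : last (rho 0) (mkseq (fun k => rho k.+1) i) = rho i.
  by case: (i) => // k; rewrite mkseqS last_rcons.
have eq1 : rho i.+1 = (sigma (ext_play rho i) (ext_memory rho i)).1.
  by rewrite cons // mkseq_recl tauE ?last_r // move_of_play.
by rewrite /= /ext_step eq1 -eq2 -surjective_pairing.
Qed.

End Extension.

Theorem lemma6 (C : finType) (C_nonempty : (0 < #|C|)%N)
    (A : arena C) (D : dfa C) (eps_notin : ~~ dfa_lang D [::])
    (tau : seq A -> A) (tauP : is_tau D tau) (v : A) :
  (rstar (accepting A D) (v, init D v)
     <= strategy_value1 (dfa_lang D) tau v)%O.
Proof.
apply: le_infimum_top => _ [rho [playr <- cons] <-].
have [p bound] : exists p, forall j, (p < j)%N ->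
    ext_play D rho j \in accepting A D ->
    rstar (accepting A D) (ext_play D rho 0) <=
      Some (infix_weight (ext_play D rho) p j).
  case: (pselect (accepting A D = finset.set0)) => [acc0|acc_n0].
    (* Without accepting vertices every minimum is over the empty set. *)
    by exists 0 => j _; rewrite acc0 inE.
  have [f fF] : exists f, f \in accepting A D by apply/set0Pn/eqP.
  have [_ /(_ acc_n0) [sigma specP tauE]] := tauP.
  (* Position 0 is a valid start, as the memory begins at the initial vertex. *)
  apply: (tau'_value (m := ext_memory D rho) fF specP) => //.
    exact: is_play_ext_play.
  exact: ext_play_consistent tauE cons.
apply: le_trans (le_enat_supremum _); last by exists p.
apply: le_infimum_top => _ [j [ltpj Kj] <-].
rewrite -(infix_weight_ext_play D); apply: bound => //.
by rewrite mem_accepting_ext_play.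
Qed.
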